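(* Let $n\in\mathbb{N}$, $i\in\{1,\dots,n-1\}$, let $H$ be an $i$-dimensional linear subspace of $\mathbb{R}^n$, let $\mathcal{B}=\mathcal{K}^n$ or $\mathcal{B}=\mathcal{K}^n_n$, and let $\diamondsuit:\mathcal{B}\to\mathcal{B}_H$ be a symmetrization. If $\diamondsuit$ is strictly monotonic, idempotent and invariant on $H$-symmetric spherical cylinders, then $\diamondsuit$ is projection invariant, i.e. $(\diamondsuit K)|H=K|H$ for all $K\in\mathcal{B}$.
   Context: $\mathcal{K}^n$ is the family of all nonempty compact convex subsets of $\mathbb{R}^n$, and $\mathcal{K}^n_n$ is the family of those with nonempty interior (convex bodies). For a linear subspace $H$, $A|H$ is the orthogonal projection of the set or point $A$ onto $H$, and $H^\perp$ is the orthogonal complement of $H$. A set is $H$-symmetric if it is invariant under the reflection in $H$, $x\mapsto 2(x|H)-x$. $\mathcal{B}_H$ is the family of all $H$-symmetric members of $\mathcal{B}$. A symmetrization is any map $\diamondsuit:\mathcal{B}\to\mathcal{B}_H$. $B_2^n$ is the closed Euclidean unit ball of $\mathbb{R}^n$ centred at the origin. $\diamondsuit$ is strictly monotonic if $K,L\in\mathcal{B}$, $K\subsetneq L$ imply $\diamondsuit K\subsetneq\diamondsuit L$. It is idempotent if $\diamondsuit\diamondsuit K=\diamondsuit K$ for all $K\in\mathcal{B}$. An $H$-symmetric spherical cylinder is any set of the form $(r(B_2^n\cap H)+x)+s(B_2^n\cap H^\perp)$ with $r,s>0$, $x\in H$; $\diamondsuit$ is invariant on $H$-symmetric spherical cylinders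 if $\diamondsuit C=C$ for every such cylinder $C$. *)

(* Defs.v *)
From HB Require Import structures.
From mathcomp Require Import all_boot all_order all_algebra.
From mathcomp Require Import all_classical all_reals all_analysis.

Set Implicit Arguments.
Unset Strict Implicit.
Unset Printing Implicit Defensive.

Import Order.TTheory GRing.Theory Num.Theory.
Import numFieldNormedType.Exports.

Local Open Scope classical_set_scope.
Local Open Scope ring_scope.

Section Euclidean.
Variables (R : realType) (n : nat).
Implicit Types (u v x : 'rV[R]_n) (H : {vspace 'rV[R]_n}).

Definition dot u v : R := \sum_(j < n) u 0 j * v 0 j.

Fact dot_is_bilinear : bilinear_for
  (GRing.Scale.Law.clone _ _ *%R _) (GRing.Scale.Law.clone _ _ *%R _) dot.
Proof.
split=> [v|u] a x y.
- rewrite /dot /= mulr_sumr -big_split; apply: eq_bigr => j _.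
  by rewrite !mxE mulrDl mulrA.
- rewrite /dot /= mulr_sumr -big_split; apply: eq_bigr => j _.
  by rewrite !mxE mulrDr mulrCA.
Qed.

HB.instance Definition _ :=
  bilinear_isBilinear.Build R _ _ _ *%R (idfun \; *%R) dot dot_is_bilinear.

Fact dot_is_symmetric u v : dot u v = (-1) ^+ false * idfun (dot v u).
Proof.
by rewrite expr0 mul1r; apply: eq_bigr => j _; rewrite mulrC.
Qed.

HB.instance Definition _ :=
  isHermitianSesquilinear.Build R _ false idfun dot dot_is_symmetric.

Fact dot_is_dot u : u != 0 -> 0 < dot u u.
Proof.
move=> u0; rewrite lt_def sumr_ge0 ?andbT => [|j _]; last first.
  by rewrite -expr2 sqr_ge0.
apply: contra u0 => /eqP /psumr_eq0P uu0; apply/eqP/rowP => j; rewrite mxE.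
by apply/eqP; rewrite -sqrf_eq0 expr2 uu0 // => k _; rewrite -expr2 sqr_ge0.
Qed.

HB.instance Definition _ := isDotProduct.Build R _ dot dot_is_dot.

Definition enorm u : R := Num.sqrt (dot u u).

Definition orthc H : {vspace 'rV[R]_n} := orthov dot H.

(* The projection onto H parallel to its orthogonal complement. *)
Definition oproj H : 'End('rV[R]_n) := daddv_pi H (orthc H).

Lemma orthcP H u :
  reflect (forall v, v \in H -> dot u v = 0) (u \in orthc H).
Proof. exact: mem_orthovP. Qed.

Lemma capv_orthc H : (H :&: orthc H)%VS = 0%VS.
Proof.
apply/eqP; rewrite -subv0; apply/subvP => u; rewrite memv_cap memv0.
move=> /andP[uH /orthcP/(_ _ uH) uu0]; apply: contraT => /dot_is_dot.
by rewrite uu0 ltxx.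
Qed.

Lemma addv_orthc H : (H + orthc H)%VS = fullv.
Proof.
have codim (k : nat) (b : nat -> 'rV[R]_n) :
    (\dim {:'rV[R]_n} <=
      k + \dim (\bigcap_(j < k) orthov dot <[b j]>)%VS)%N.
  elim: k => [|k IHk]; first by rewrite big_ord0.
  rewrite big_ord_recr /= (leq_trans IHk) // addSnnS leq_add2l.
  apply: leq_trans (leqSpred _) _; rewrite ltnS.
  exact: leq_dim_orthov1.
apply/eqP; rewrite eqEdim subvf /= dimv_disjoint_sum ?capv_orthc //.
have := codim (\dim H) (nth 0 (vbasis H)).
by under eq_bigr do rewrite orthov1E.
Qed.

Lemma orthc_oproj H x : x - oproj H x \in orthc H.
Proof.
have xHC : x \in (H + orthc H)%VS by rewrite addv_orthc memvf.
rewrite -[X in X - _](daddv_pi_add (capv_orthc H) xHC) addrAC subrr add0r.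
exact: memv_pi.
Qed.

Lemma oproj_mem H x : oproj H x \in H.
Proof. exact: memv_pi. Qed.

Definition reflection H x : 'rV[R]_n := 2 *: oproj H x - x.

Definition Kn : set (set 'rV[R]_n) :=
  [set K : set 'rV[R]_n | [/\ K !=set0, compact K & convex_set K]].

Definition Knn : set (set 'rV[R]_n) := [set K | Kn K /\ K° !=set0].

Definition symmetric_set H (K : set 'rV[R]_n) : Prop :=
  reflection H @` K = K.

Definition symmetric_part H (B : set (set 'rV[R]_n)) : set (set 'rV[R]_n) :=
  B `&` [set K | symmetric_set H K].

(* A map B -> B_H is encoded as a total map on sets which sends B into B_H;
   its values outside B are irrelevant, as all the properties below only
   involve members of B. *)
Definition symmetrization H (B : set (set 'rV[R]_n))
    (diam : set 'rV[R]_n -> set 'rV[R]_n) : Prop :=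
  set_fun B (symmetric_part H B) diam.

Definition strictly_monotonic (B : set (set 'rV[R]_n))
    (diam : set 'rV[R]_n -> set 'rV[R]_n) : Prop :=
  forall K L, B K -> B L -> K `<` L -> diam K `<` diam L.

Definition idempotent_on (B : set (set 'rV[R]_n))
    (diam : set 'rV[R]_n -> set 'rV[R]_n) : Prop :=
  forall K, B K -> diam (diam K) = diam K.

Definition unit_ball : set 'rV[R]_n := [set u | enorm u <= 1].

Definition spherical_cylinder H (r s : R) x : set 'rV[R]_n :=
  [set (r *: u + x) + s *: v | u in unit_ball `&` [set` H]
                             & v in unit_ball `&` [set` orthc H]].

Definition cylinder_invariant H (diam : set 'rV[R]_n -> set 'rV[R]_n) : Prop :=
  forall (r s : R) x, 0 < r -> 0 < s -> x \in H ->
    diam (spherical_cylinder H r s x) = spherical_cylinder H r s x.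

Definition projection_invariant H (B : set (set 'rV[R]_n))
    (diam : set 'rV[R]_n -> set 'rV[R]_n) : Prop :=
  forall K, B K -> oproj H @` diam K = oproj H @` K.

End Euclidean.

Arguments Kn : clear implicits.
Arguments Knn : clear implicits.

(* Main.v *)
Require Import Defs.
From mathcomp Require Import all_boot all_order all_algebra.
From mathcomp Require Import all_classical all_reals all_analysis.
From mathcomp Require Import ring lra.
Import Order.TTheory GRing.Theory Num.Theory.
Import numFieldNormedType.Exports.
Local Open Scope classical_set_scope.
Local Open Scope ring_scope.

(** Write [P] for the orthogonal projection onto [H].  The result comes from
    monotonicity with respect to inclusion and from the invariance of the
    cylinders, by two inclusions.

    Upper inclusion, [oproj_diam_sub].  A compact convex subset of [H] is the
    intersection of the balls of [H] that contain it.  If a ball [D] of [H]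
    contains [P K], then [K] lies in the cylinder over [D] as soon as its
    height is large enough; this cylinder is fixed by the symmetrization, so
    by monotonicity it also contains the image of [K], whose projection
    therefore lies in [D].  The ball that leaves out a given point [y] outside
    [P K] is found in [cylinder_separation]: [P K] lies on the far side of the
    hyperplane orthogonal to the segment from [y] to its nearest point in
    [P K], and a ball of large radius, centred behind that nearest point,
    approximates this half space closely enough.

    Lower inclusion, [sub_oproj_diam].  For [a] in [K], the copy [K'] of [K]
    contracted towards [a] with ratio [e] is contained in [K] and is again
    compact convex, with nonempty interior if [K] has one.  Its image is
    nonempty, is contained in the image of [K] by monotonicity, and projects
    into [P K'] by the upper inclusion.  Hence the projection of the image of
    [K] comes within a distance [O(e)] of [P a], and by compactness it
    contains [P a].  Contractions are used instead of the singleton of [a] so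
    that the argument also covers convex bodies. *)

(** * Squared norms and orthogonal projections *)

Section Euclidean.
Set Implicit Arguments.
Unset Strict Implicit.
Variables (R : realType) (n : nat).
Implicit Types (u v w x y c : 'rV[R]_n) (A K : set 'rV[R]_n).
Implicit Types H : {vspace 'rV[R]_n}.

Definition sqnorm u : R := dot u u.

Lemma sqnorm_ge0 u : 0 <= sqnorm u.
Proof. by apply: sumr_ge0 => j _; rewrite -expr2 sqr_ge0. Qed.

Lemma sqnorm_gt0 u : u != 0 -> 0 < sqnorm u.
Proof. exact: dot_is_dot. Qed.

(** Distances to points of a segment or a ray are expanded in this way, which
    leaves polynomial inequalities over the reals. *)
Lemma sqnormD (a b : R) u v :
  sqnorm (a *: u + b *: v)
  = a ^+ 2 * sqnorm u + 2 * a * b * dot u v + b ^+ 2 * sqnorm v.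
Proof.
rewrite /sqnorm /dot !mulr_sumr -!big_split /=; apply: eq_bigr => j _.
by rewrite !mxE; ring.
Qed.

Lemma sqnormZ (a : R) u : sqnorm (a *: u) = a ^+ 2 * sqnorm u.
Proof.
by have := sqnormD a 0 u 0; rewrite scale0r addr0 => ->; ring.
Qed.

Lemma sqnorm_convex (t : R) u v : 0 <= t -> t <= 1 ->
  sqnorm (t *: u + (1 - t) *: v) <= t * sqnorm u + (1 - t) * sqnorm v.
Proof.
move=> t0 t1; rewrite sqnormD.
(* The defect of convexity is t (1 - t) times the squared norm of u - v. *)
have t1' : 0 <= 1 - t by rewrite subr_ge0.
have := mulr_ge0 (mulr_ge0 t0 t1') (sqnorm_ge0 (1 *: u + (-1) *: v)).
rewrite sqnormD; lra.
Qed.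

Lemma sqr_coord_le_sqnorm u j : `|u 0 j| ^+ 2 <= sqnorm u.
Proof.
rewrite real_normK ?num_real// /sqnorm /dot (bigD1 j)//= -expr2 lerDl.
by apply: sumr_ge0 => k _; rewrite -expr2 sqr_ge0.
Qed.

(** The norm of the matrix topology is the maximum norm, hence the detour
    through coordinates. *)
Lemma bounded_sqnorm A c (M : R) :
  (forall x, A x -> sqnorm (x - c) <= M) -> bounded_set A.
Proof.
move=> AM; exists (1 + M + `|c|); split; first exact: num_real.
move=> N MN x Ax /=.
rewrite -(subrK c x) (le_trans (ler_normD _ _))// -lerBrDr.
rewrite [leLHS]/Num.norm/= mx_normrE; apply: bigmax_le => [|[i j] _ /=].
  have := AM _ Ax; have := sqnorm_ge0 (x - c); lra.
rewrite (ord1 i).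
have := sqr_coord_le_sqnorm (x - c) j; have := AM _ Ax.
set a := `|_|; have : 0 <= a by exact: normr_ge0.
by nra.
Qed.

Lemma lfun_coord_continuous (f : 'End('rV[R]_n)) j :
  continuous (fun x => f x 0 j : R).
Proof.
rewrite (_ : (fun x => _) = fun x => \sum_k x 0 k * lin1_mx f k j :> R).
  apply: continuous_big => [|k _ x]; first exact: add_continuous.
  by apply: continuousM; [exact: coord_continuous|exact: cst_continuous].
by apply/funext => x; rewrite -[f x]mul_rV_lin1 mxE.
Qed.

Lemma sqnorm_continuous (f : 'End('rV[R]_n)) c :
  continuous (fun x => sqnorm (f x - c)).
Proof.
apply: continuous_big => [|j _ x]; first exact: add_continuous.
have fc : continuous (fun y => f y 0 j - c 0 j : R).
  move=> y; apply: continuousB; first exact: lfun_coord_continuous.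
  exact: cst_continuous.
under eq_fun do rewrite !mxE.
exact: continuousM (fc x) (fc x).
Qed.

(** Trades the bundled coefficients of abstract convex spaces for explicit
    scalars in the unit interval. *)
Lemma convex_setP A : convex_set A <->
  forall x y (t : R), A x -> A y -> 0 <= t -> t <= 1 ->
    A (t *: x + (1 - t) *: y).
Proof.
split=> [cA x y t Ax Ay t0 t1|cA x y t].
  have := cA x y (Itv01 t0 t1).
  by rewrite !inE => /(_ Ax Ay).
by rewrite !inE => Ax Ay; apply: cA.
Qed.

Lemma oproj_id H u : u \in H -> oproj H u = u.
Proof. exact: daddv_pi_id (capv_orthc H). Qed.

Lemma oproj_orthc H v : v \in orthc H -> oproj H v = 0.
Proof.
move=> vH; have := daddv_pi_add (capv_orthc H) (_ : v \in (H + orthc H)%VS).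
rewrite addv_orthc memvf => /(_ isT).
have CH : (orthc H :&: H)%VS = 0%VS by rewrite capvC capv_orthc.
rewrite (daddv_pi_id CH vH) => /eqP.
by rewrite -subr_eq0 addrK => /eqP.
Qed.

(** * Spherical cylinders are convex bodies *)

Lemma enorm_le (u : 'rV[R]_n) (r : R) : 0 <= r ->
  (enorm u <= r) = (sqnorm u <= r ^+ 2).
Proof.
by move=> r0; rewrite -(ler_sqr (sqrtr_ge0 _))// sqr_sqrtr// sqnorm_ge0.
Qed.

(** The horizontal and vertical parts of a point can be bounded separately;
    in this form a cylinder is an intersection of two sublevel sets of
    continuous convex functions. *)
Lemma spherical_cylinderE H (r s : R) c : 0 < r -> 0 < s -> c \in H ->
  spherical_cylinder H r s c =
  [set x | sqnorm (oproj H x - c) <= r ^+ 2 /\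
           sqnorm (x - oproj H x) <= s ^+ 2].
Proof.
move=> r0 s0 cH; apply/seteqP; split=> x /=.
  move=> [u [/= u1 uH]] [v [/= v1 vH] <-].
  have Px : oproj H (r *: u + c + s *: v) = r *: u + c.
    rewrite linearD/= oproj_id ?memvD ?memvZ// oproj_orthc ?addr0//.
    exact: memvZ.
  move: u1 v1; rewrite Px !addrK [_ + s *: v]addrC addrK !sqnormZ.
  rewrite /unit_ball/= !enorm_le// expr1n => u1 v1.
  by split; rewrite ler_piMr// sqr_ge0.
move=> [xr xs]; exists (r^-1 *: (oproj H x - c)).
  split; rewrite /unit_ball /=; last by rewrite memvZ// memvB// oproj_mem.
  by rewrite enorm_le// expr1n sqnormZ exprVn ler_pdivrMl ?exprn_gt0// mulr1.
exists (s^-1 *: (x - oproj H x)).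
  split; rewrite /unit_ball /=; last by rewrite memvZ// orthc_oproj.
  by rewrite enorm_le// expr1n sqnormZ exprVn ler_pdivrMl ?exprn_gt0// mulr1.
by rewrite !scalerA !divff ?gt_eqF// !scale1r subrK addrC subrK.
Qed.

Lemma sqnorm_orthc_continuous H : continuous (fun x => sqnorm (x - oproj H x)).
Proof.
have -> : (fun x => sqnorm (x - oproj H x)) =
    (fun x => sqnorm ((\1 - oproj H)%VF x - 0)).
  by apply/funext => x; rewrite subr0 add_lfunE opp_lfunE id_lfunE.
exact: sqnorm_continuous.
Qed.

Lemma spherical_cylinder_Knn H (r s : R) c : 0 < r -> 0 < s -> c \in H ->
  Knn R n (spherical_cylinder H r s c).
Proof.
move=> r0 s0 cH; rewrite spherical_cylinderE//.
have f1 : continuous (fun x => sqnorm (oproj H x - c)).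
  exact: sqnorm_continuous.
have f2 : continuous (fun x => sqnorm (x - oproj H x)).
  exact: sqnorm_orthc_continuous.
have r2 : 0 < r ^+ 2 by rewrite exprn_gt0.
have s2 : 0 < s ^+ 2 by rewrite exprn_gt0.
have center : sqnorm (oproj H c - c) = 0 /\ sqnorm (c - oproj H c) = 0.
  by rewrite oproj_id// subrr -(scale0r 0) sqnormZ expr0n mul0r.
split; first split.
- by exists c; rewrite /= center.1 center.2 !ltW.
- apply: bounded_closed_compact.
    apply: (@bounded_sqnorm _ c (2 * (r ^+ 2 + s ^+ 2))) => x /= [xr xs].
    have -> : x - c = 1 *: (oproj H x - c) + 1 *: (x - oproj H x).
      by rewrite !scale1r [RHS]addrC addrA subrK.
    rewrite sqnormD.
    (* The parallelogram inequality yields the factor 2 of the bound. *)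
    have := sqnorm_ge0 (1 *: (oproj H x - c) + (-1) *: (x - oproj H x)).
    rewrite sqnormD; lra.
  rewrite (_ : mkset _ =
    (fun x => sqnorm (oproj H x - c)) @^-1` [set y | y <= r ^+ 2] `&`
    (fun x => sqnorm (x - oproj H x)) @^-1` [set y | y <= s ^+ 2]) //.
  move/continuous_closedP: f1 => f1; move/continuous_closedP: f2 => f2.
  by apply: closedI; [apply: f1|apply: f2]; exact: closed_le.
- apply/convex_setP => x y t /= [xr xs] [yr ys] t0 t1.
  rewrite linearD/= !linearZ/=; split.
    have -> : t *: oproj H x + (1 - t) *: oproj H y - c =
        t *: (oproj H x - c) + (1 - t) *: (oproj H y - c).
      by rewrite !scalerBr addrACA -opprD -scalerDl subrKC scale1r.
    apply: (le_trans (sqnorm_convex _ _ t0 t1)); nra.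
  have -> : t *: x + (1 - t) *: y - (t *: oproj H x + (1 - t) *: oproj H y) =
      t *: (x - oproj H x) + (1 - t) *: (y - oproj H y).
    by rewrite !scalerBr addrACA -opprD.
  apply: (le_trans (sqnorm_convex _ _ t0 t1)); nra.
- pose U := (fun x => sqnorm (oproj H x - c)) @^-1` [set y | y < r ^+ 2] `&`
    (fun x => sqnorm (x - oproj H x)) @^-1` [set y | y < s ^+ 2].
  have oU : open U.
    move/continuousP: f1 => f1; move/continuousP: f2 => f2.
    by apply: openI; [apply: f1|apply: f2]; exact: open_lt.
  have : U `<=` [set x | sqnorm (oproj H x - c) <= r ^+ 2 /\
                         sqnorm (x - oproj H x) <= s ^+ 2].
    by move=> x [] /= /ltW ? /ltW ?.
  rewrite open_subsetE// => UC; exists c; apply: UC.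
  by rewrite /U /= center.1 center.2.
Qed.

(** * Contractions towards a point *)

Definition homothety (a : 'rV[R]_n) (e : R) (x : 'rV[R]_n) : 'rV[R]_n :=
  (1 - e) *: a + e *: x.

Lemma homothety_continuous a e : continuous (homothety a e).
Proof.
rewrite /homothety => x; apply: (@continuousD _ _ _ (cst _)).
  exact: cst_continuous.
exact: scaler_continuous.
Qed.

Lemma homothety_sub a e A : convex_set A -> A a -> 0 <= e -> e <= 1 ->
  homothety a e @` A `<=` A.
Proof.
move=> /convex_setP cA Aa e0 e1 _ [x Ax <-].
by rewrite /homothety addrC; exact: cA.
Qed.

Lemma homothety_Kn a e A : Kn R n A -> Kn R n (homothety a e @` A).
Proof.
move=> [[z Az] kA /convex_setP cA]; split.
- by exists (homothety a e z); exists z.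
- apply: continuous_compact kA.
  by apply: continuous_subspaceT; exact: homothety_continuous.
- apply/convex_setP => _ _ t [x Ax <-] [y Ay <-] t0 t1.
  exists (t *: x + (1 - t) *: y); first exact: cA.
  by apply/rowP => j; rewrite !mxE; ring.
Qed.

Lemma homothety_Knn a e A : 0 < e -> Knn R n A -> Knn R n (homothety a e @` A).
Proof.
move=> e0 [AK [z Az]]; split; first exact: homothety_Kn.
have e1 : e != 0 by rewrite gt_eqF.
have sK : cancel (homothety a e) (homothety a e^-1).
  by move=> x; apply/rowP => j; rewrite !mxE; field.
have gsK : cancel (homothety a e^-1) (homothety a e).
  by move=> x; apply/rowP => j; rewrite !mxE; field.
have oV : open (homothety a e^-1 @^-1` A°).
  have /continuousP : continuous (homothety a e^-1).
    exact: homothety_continuous.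
  by apply; exact: open_interior.
have : homothety a e^-1 @^-1` A° `<=` homothety a e @` A.
  by move=> y /interior_subset Ay; exists (homothety a e^-1 y).
rewrite open_subsetE// => VA; exists (homothety a e z); apply: VA.
by rewrite /preimage/= sK.
Qed.

(** * Separation by cylinders *)

Lemma sqnorm_min H K y : K !=set0 -> compact K ->
  exists2 d, K d & forall k, K k ->
    sqnorm (oproj H d - y) <= sqnorm (oproj H k - y).
Proof.
move=> K0 cK.
have [|d /set_mem Kd dmin] :=
    @compact_EVT_min _ R (fun x => sqnorm (oproj H x - y)) K K0 cK.
  by apply: continuous_subspaceT; exact: sqnorm_continuous.
by exists d => // k /mem_set; exact: dmin.
Qed.

(** The variational inequality of the nearest point: moving from [P d] towards
    [P k] by a small step [t] changes the squared distance to [y] by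
    [- 2 t D + O(t^2)], where [D] is the scalar product below, so [D] cannot
    be positive. *)
Lemma obtuse_angle H K d y : convex_set K -> K d ->
  (forall k, K k -> sqnorm (oproj H d - y) <= sqnorm (oproj H k - y)) ->
  forall k, K k -> dot (oproj H k - oproj H d) (y - oproj H d) <= 0.
Proof.
move=> /convex_setP cK Kd dmin k Kk; rewrite leNgt; apply/negP.
set p := _ - oproj H d; set w := y - _ => D0; set D := dot p w in D0.
have p0 := sqnorm_ge0 p.
have pD : 0 < sqnorm p + D by lra.
(* With this t the term of second order is at most t D. *)
have [t [t0 t1 tE]] : exists t, [/\ 0 < t, t <= 1 & t * (sqnorm p + D) = D].
  exists (D / (sqnorm p + D)); rewrite divr_gt0// ler_pdivrMr// mul1r lerDr.
  by rewrite divfK// gt_eqF.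
have := dmin _ (cK _ _ _ Kk Kd (ltW t0) t1).
have -> : oproj H (t *: k + (1 - t) *: d) - y = t *: p + (-1) *: w.
  by rewrite linearD/= !linearZ/=; apply/rowP => j; rewrite /p /w !mxE; ring.
have -> : oproj H d - y = 0 *: p + (-1) *: w.
  by rewrite scale0r add0r scaleN1r /w opprB.
rewrite !sqnormD -/D => h.
have : 0 < t * D by rewrite mulr_gt0.
have : t * (t * (sqnorm p + D)) = t * D by rewrite tE.
nra.
Qed.

Lemma continuous_compact_ub (f : 'rV[R]_n -> R) K : K !=set0 -> compact K ->
  continuous f -> exists M, forall k, K k -> f k <= M.
Proof.
move=> K0 cK cf.
have [|d _ dmax] := @compact_EVT_max _ R f K K0 cK.
  exact: continuous_subspaceT.
by exists (f d) => k /mem_set; exact: dmax.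
Qed.

(** With [P d] the point of [P K] nearest to [y] and [w = y - P d], the centre
    is [c = P d - t w].  If [M] bounds the squared distances from [P d] to the
    points of [P K], then by the obtuse angle these points are at squared
    distance at most [M + t^2 |w|^2] from [c], while [y] is at squared distance
    [(1 + t)^2 |w|^2], which is larger once [M < (1 + 2 t) |w|^2]. *)
Lemma cylinder_separation H K y : Kn R n K -> y \in H ->
    ~ (oproj H @` K) y ->
  exists r s c, [/\ 0 < r, 0 < s, c \in H,
    K `<=` spherical_cylinder H r s c &
    ~ (oproj H @` spherical_cylinder H r s c) y].
Proof.
move=> [K0 cK convK] yH yK.
have [d Kd dmin] := sqnorm_min H y K0 cK.
have obtuse := obtuse_angle convK Kd dmin.
have [M KM] : exists M, forall k, K k -> sqnorm (oproj H k - oproj H d) <= M.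
  by apply: continuous_compact_ub => //; exact: sqnorm_continuous.
have [S KS] : exists S, forall k, K k -> sqnorm (k - oproj H k) <= S.
  by apply: continuous_compact_ub => //; exact: sqnorm_orthc_continuous.
set w := y - oproj H d in obtuse.
have w0 : 0 < sqnorm w.
  apply: sqnorm_gt0; rewrite subr_eq0; apply/eqP => yd.
  by apply: yK; exists d.
have M0 : 0 <= M by exact: le_trans (sqnorm_ge0 _) (KM _ Kd).
have S0 : 0 <= S by exact: le_trans (sqnorm_ge0 _) (KS _ Kd).
(* The squared radius r2 lies strictly between the two bounds for this t; the
   summand sqnorm w / 2 keeps it positive when M = 0. *)
have [t [t0 tw]] : exists t, 0 <= t /\ t * sqnorm w = M.
  by exists (M / sqnorm w); rewrite divfK ?gt_eqF// divr_ge0// ltW.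
pose r2 := M + t ^+ 2 * sqnorm w + sqnorm w / 2.
have r20 : 0 < r2.
  have : 0 <= t ^+ 2 * sqnorm w by rewrite mulr_ge0 ?sqr_ge0 ?ltW.
  rewrite /r2; lra.
pose c := oproj H d - t *: w.
have cH : c \in H by rewrite memvB ?memvZ ?memvB ?oproj_mem.
have s0 : 0 < S + 1 by lra.
exists (Num.sqrt r2), (S + 1), c; split; rewrite ?sqrtr_gt0//.
  rewrite spherical_cylinderE ?sqrtr_gt0// => k Kk /=.
  rewrite sqr_sqrtr ?(ltW r20)//; split; last by have := KS _ Kk; nra.
  have -> : oproj H k - c = 1 *: (oproj H k - oproj H d) + t *: w.
    by apply/rowP => j; rewrite /c !mxE; ring.
  have := KM _ Kk; have := mulr_ge0_le0 t0 (obtuse _ Kk).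
  rewrite sqnormD /r2; lra.
rewrite spherical_cylinderE ?sqrtr_gt0// => -[x /= [+ _] xy].
rewrite sqr_sqrtr ?(ltW r20)// xy.
have -> : y - c = (1 + t) *: w by apply/rowP => j; rewrite /c /w !mxE; ring.
rewrite sqnormZ /r2; nra.
Qed.

(** * Monotone maps that fix the cylinders *)

(** The families of compact convex sets and of convex bodies are treated
    together: both contain the convex bodies and are stable under
    contractions. *)
Section Monotone.
Variables (H : {vspace 'rV[R]_n}) (B : set (set 'rV[R]_n)).
Variable diam : set 'rV[R]_n -> set 'rV[R]_n.
Hypothesis B_Kn : B `<=` Kn R n.
Hypothesis Knn_B : Knn R n `<=` B.
Hypothesis B_homothety : forall a e K, 0 < e -> B K -> B (homothety a e @` K).
Hypothesis diam_B : forall K, B K -> B (diam K).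
Hypothesis diam_homo : forall K L, B K -> B L -> K `<=` L -> diam K `<=` diam L.
Hypothesis diam_cyl : cylinder_invariant H diam.

(** A point outside [P K] is cut off by a cylinder around [K], which by
    monotonicity is also a cylinder around the image of [K]. *)
Lemma oproj_diam_sub K : B K -> oproj H @` diam K `<=` oproj H @` K.
Proof.
move=> BK y Py; apply: contrapT => nPy.
have yH : y \in H by case: Py => x _ <-; exact: oproj_mem.
have [r [s [c [r0 s0 cH KC]]]] := cylinder_separation (B_Kn BK) yH nPy.
apply; case: Py => x Kx xy; exists x => //.
rewrite -diam_cyl//; apply: (diam_homo _ _ KC) => //.
by apply: Knn_B; exact: spherical_cylinder_Knn.
Qed.

(** The distance from [P a] to the projection of the image of [K] is attained,
    and testing it on the images of contractions of [K] towards [a] bounds it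
    by arbitrarily small numbers. *)
Lemma sub_oproj_diam K : B K -> oproj H @` K `<=` oproj H @` diam K.
Proof.
move=> BK _ [a Ka <-].
have [K0 cK convK] := B_Kn BK.
have [dK0 cdK _] := B_Kn (diam_B BK).
have [d Kd dmin] := sqnorm_min H (oproj H a) dK0 cdK.
have [M KM] : exists M, forall k, K k -> sqnorm (oproj H k - oproj H a) <= M.
  by apply: continuous_compact_ub => //; exact: sqnorm_continuous.
set D := sqnorm _ in dmin.
have DM e : 0 < e -> e <= 1 -> D <= e ^+ 2 * M.
  move=> e0 e1; have BL := B_homothety a e0 BK.
  have LK : homothety a e @` K `<=` K by apply: homothety_sub => //; exact: ltW.
  have [[x Lx] _ _] := B_Kn (diam_B BL).
  have [|_ [k Kk <-] xk] := @oproj_diam_sub _ BL (oproj H x).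
    by exists x.
  apply: le_trans (dmin _ (diam_homo BL BK LK Lx)) _.
  have -> : oproj H x - oproj H a = e *: (oproj H k - oproj H a).
    rewrite -xk /homothety linearD/= !linearZ/=.
    by apply/rowP => j; rewrite !mxE; ring.
  by rewrite sqnormZ ler_wpM2l ?sqr_ge0// KM.
exists d => //; apply/eqP; rewrite -subr_eq0; apply: contraT => /sqnorm_gt0.
rewrite -/D => D0.
have M0 : D <= M by have := DM 1 ltr01 (lexx _); rewrite expr1n mul1r.
(* The ratio D / (2 M) turns the bound e^2 M into D^2 / (4 M) <= D / 4. *)
have M1 : 0 < 2 * M by lra.
have e0 : 0 < D / (2 * M) by rewrite divr_gt0.
have e1 : D / (2 * M) <= 1 by rewrite ler_pdivrMr//; lra.
have eM : D / (2 * M) * (2 * M) = D by rewrite divfK// gt_eqF.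
have := DM _ e0 e1.
nra.
Qed.

End Monotone.

End Euclidean.

Theorem theorem3p1 (R : realType) (n i : nat) (hi : (1 <= i <= n - 1)%N)
    (H : {vspace 'rV[R]_n}) (hH : \dim H = i)
    (B : set (set 'rV[R]_n)) (hB : B = Kn R n \/ B = Knn R n)
    (diam : set 'rV[R]_n -> set 'rV[R]_n)
    (diam_sym : symmetrization H B diam)
    (diam_mono : strictly_monotonic B diam)
    (diam_idem : idempotent_on B diam)
    (diam_cyl : cylinder_invariant H diam) :
  projection_invariant H B diam.
Proof.
have B_Kn : B `<=` Kn R n by case: hB => -> // K [].
have Knn_B : Knn R n `<=` B by case: hB => -> // K [].
have B_homothety a e K : 0 < e -> B K -> B (homothety a e @` K).
  by case: hB => -> e0; [exact: homothety_Kn|exact: homothety_Knn].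
have diam_B K : B K -> B (diam K) by move=> /diam_sym[].
have diam_homo K L : B K -> B L -> K `<=` L -> diam K `<=` diam L.
  move=> BK BL KL; have [->//|/eqP neqKL] := pselect (K = L).
  by apply: properW; apply: diam_mono => //; rewrite properEneq.
move=> K BK; apply/seteqP; split.
  exact: (oproj_diam_sub B_Kn).
exact: (sub_oproj_diam B_Kn).
Qed.
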